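(* Let $n$ be any positive odd integer. Then $$\sum_{j,k=0}^{n-1}\frac{1}{\sin(2\pi(x+j)/n)+\sin(2\pi(y+k)/n)}=\left(\frac{-1}{n}\right)\frac{n^2}{\sin 2\pi x+\sin 2\pi y}$$ for all $x,y\in\mathbb{C}$ with $x+y\notin\mathbb{Z}$ and $x-y-\frac12\notin\mathbb{Z}$, and $$\sum_{j,k=0}^{n-1}\frac{1}{\cos(2\pi(x+j)/n)+\cos(2\pi(y+k)/n)}=\frac{n^2}{\cos 2\pi x+\cos 2\pi y}$$ for all $x,y\in\mathbb{C}$ with $x+y-\frac12\notin\mathbb{Z}$ and $x-y-\frac12\notin\mathbb{Z}$. Also, $$\sum_{j,k=0}^{n-1}\frac{1}{\sin(2\pi(x+j)/n)+\cos(2\pi(y+k)/n)}=\frac{n^2}{\left(\frac{-1}{n}\right)\sin 2\pi x+\cos 2\pi y}$$ for all $x,y\in\mathbb{C}$ with $x+y+(-1)^{(n-1)/2}/4\notin\mathbb{Z}$ and $x-y+(-1)^{(n-1)/2}/4\notin\mathbb{Z}$.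
   Context: For a positive odd integer $n$, $\left(\frac{\cdot}{n}\right)$ denotes the Jacobi symbol; in particular $\left(\frac{-1}{n}\right)=(-1)^{(n-1)/2}$. The sums over $j,k$ run over all pairs $(j,k)$ with $j,k\in\{0,\ldots,n-1\}$. *)

(* Defs.v *)
From mathcomp Require Import all_boot all_order all_algebra.
From mathcomp Require Import all_classical all_reals all_analysis.
From mathcomp Require Import complex.

Set Implicit Arguments.
Unset Strict Implicit.
Unset Printing Implicit Defensive.

Import Order.TTheory GRing.Theory Num.Theory.

Local Open Scope ring_scope.
Local Open Scope complex_scope.

(* exp (a + i b) = exp a * (cos b + i sin b) *)
Definition cexp (R : realType) (z : R[i]) : R[i] :=
  (expR (complex.Re z))%:C * (cos (complex.Im z) +i* sin (complex.Im z)).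

Definition csin (R : realType) (z : R[i]) : R[i] :=
  (cexp ((0 +i* 1) * z) - cexp (- ((0 +i* 1) * z))) / (2%:R * (0 +i* 1)).

Definition ccos (R : realType) (z : R[i]) : R[i] :=
  (cexp ((0 +i* 1) * z) + cexp (- ((0 +i* 1) * z))) / 2%:R.

Definition legendre (a : int) (p : nat) : int :=
  if (p%:Z %| a)%Z then 0
  else if [exists x : 'I_p, ((x%:Z) ^+ 2 == a %[mod p%:Z])%Z] then 1
  else -1.

(* Meaningful for odd n > 0; the empty product gives jacobi a 1 = 1. *)
Definition jacobi (a : int) (n : nat) : int :=
  \prod_(p <- primes n) legendre a p ^+ logn p n.

Definition is_integer (R : realType) (z : R[i]) : Prop :=
  exists m : int, z = m%:~R.

(* Main.v *)
(* Write u = exp(2 pi i x / n), v = exp(2 pi i y / n), u = p q, v = p / q; then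
   cos + cos factors as (p + 1/p)(q + 1/q)/2. As n is odd,
   (s, t) |-> (s + t, s - t) permutes pairs of residues mod n, and in these
   coordinates the double sum of cosines is a product of two single sums
   \sum_s 1 / (p z^s + 1 / (p z^s)), z a primitive n-th root of unity. Each one is
   computed by partial fractions at i and -i from the sum of 1 / (w z^s - c),
   and contributes a sign (-1)^((n-1)/2), so that the signs cancel. The identities
   with sines follow by shifting x (and y) by n/4. *)

Require Import Defs.
From mathcomp Require Import all_boot all_order all_algebra.
From mathcomp Require Import all_classical all_reals all_analysis.
From mathcomp Require Import complex.
From mathcomp Require Import ring lra.

Set Implicit Arguments.
Unset Strict Implicit.
Unset Printing Implicit Defensive.

Import Order.TTheory GRing.Theory Num.Theory.

Local Open Scope ring_scope.
Local Open Scope complex_scope.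

(** * Sums over the powers of a primitive root of unity in a field *)

Lemma sum_expr_prim_root (F : fieldType) (n : nat) (z : F) (m : nat) :
  n.-primitive_root z ->
  \sum_(s < n) (z ^+ s) ^+ m = if (n %| m)%N then n%:R else 0.
Proof.
move=> prim_z; under eq_bigr do rewrite exprAC.
rewrite (prim_order_dvd prim_z); case: eqVneq => [->|zm_neq1].
  by under eq_bigr do rewrite expr1n; rewrite sumr_const card_ord.
apply: (@mulfI _ (z ^+ m - 1)); first by rewrite subr_eq0.
by rewrite -subrX1 exprAC (prim_expr_order prim_z) expr1n subrr mulr0.
Qed.

(* Multiplying by (w^n - c^n) turns each term into a geometric sum, of which
   summation over s only keeps the term free of z. *)
Lemma sum_inv_root_sub (F : fieldType) (n : nat) (z w c : F) :
    n.-primitive_root z -> w ^+ n != c ^+ n ->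
  \sum_(s < n) (w * z ^+ s - c)^-1 = n%:R * c ^+ n.-1 / (w ^+ n - c ^+ n).
Proof.
case: n => [|n] prim_z wc; first by rewrite big_ord0 mul0r mul0r.
have wz (s : nat) : (w * z ^+ s) ^+ n.+1 = w ^+ n.+1.
  by rewrite exprMn exprAC (prim_expr_order prim_z) expr1n mulr1.
have tE (s : 'I_n.+1) : (w * z ^+ s - c)^-1 =
    (\sum_(k < n.+1) w ^+ (n - k) * (z ^+ s) ^+ (n - k) * c ^+ k)
      / (w ^+ n.+1 - c ^+ n.+1).
  have h : (w * z ^+ s) ^+ n.+1 - c ^+ n.+1 != 0 by rewrite wz subr_eq0.
  have h' : w * z ^+ s - c != 0.
    by apply: contraNneq h; rewrite subrXX => ->; rewrite mul0r.
  apply: (mulfI h'); rewrite mulfV // mulrA -(wz s).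
  apply: (mulIf h); rewrite mul1r divfK // subrXX; congr (_ * _).
  by apply: eq_bigr => k _; rewrite exprMn.
under eq_bigr do rewrite tE.
rewrite -mulr_suml exchange_big /=; congr (_ / _).
rewrite big_ord_recr /= big1 ?add0r => [|k _].
  rewrite subnn -mulr_suml; congr (_ * _).
  by under eq_bigr do rewrite !expr0 mulr1; rewrite sumr_const card_ord.
rewrite -mulr_suml -mulr_sumr (@sum_expr_prim_root _ n.+1) // gtnNdvd.
- by rewrite mulr0 mul0r.
- by rewrite subn_gt0.
- by rewrite ltnS leq_subr.
Qed.

Lemma sqrtN1_odd_expr (R : pzRingType) (n : nat) (i : R) :
  odd n -> i ^+ 2 = -1 -> i ^+ n = (-1) ^+ n./2 * i.
Proof.
move=> n_odd i2.
by rewrite -[in LHS](odd_double_half n) n_odd exprSr -mul2n exprM i2.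
Qed.

(** Partial fractions: the left-hand side is [u / ((u - i) * (u + i))], whose residues at [i] and
    [- i] are both 1/2. *)
Lemma inv_add_inv (F : fieldType) (i u : F) :
    2%:R != 0 :> F -> i ^+ 2 = -1 -> u + u^-1 != 0 ->
  (u + u^-1)^-1 = 2%:R^-1 * ((u - i)^-1 + (u - - i)^-1).
Proof.
move=> two0 i2; case: (eqVneq u 0) => [->|u0]; first by rewrite invr0 addr0 eqxx.
have -> : u + u^-1 = (u - i) * (u + i) / u.
  by rewrite -subr_sqr i2 opprK mulrDl expr2 mulfK // mul1r.
rewrite !mulf_eq0 !negb_or => /andP[/andP[h2 h1] _].
by rewrite opprK; field; rewrite u0 h1 h2 two0.
Qed.

Lemma add_inv_neq0 (F : fieldType) (i u : F) :
  u != 0 -> i ^+ 2 = -1 -> (u + u^-1 != 0) = (u ^+ 2 != i ^+ 2).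
Proof.
move=> u0 ->; congr (~~ _); rewrite -[RHS]subr_eq0 opprK.
have -> : u ^+ 2 + 1 = (u + u^-1) * u by rewrite mulrDl mulVf.
by rewrite mulf_eq0 (negbTE u0) orbF.
Qed.

Lemma sum_inv_add_inv (F : fieldType) (n : nat) (z p i : F) :
    odd n -> n.-primitive_root z -> 2%:R != 0 :> F -> i ^+ 2 = -1 ->
    p ^+ n + p ^- n != 0 ->
  \sum_(s < n) (p * z ^+ s + (p * z ^+ s)^-1)^-1 =
    (-1) ^+ n./2 * n%:R / (p ^+ n + p ^- n).
Proof.
move=> n_odd prim_z two0 i2 P0.
have n_gt0 : (0 < n)%N by case: (n) n_odd.
have in2 c : c ^+ 2 = -1 -> (c ^+ n) ^+ 2 = -1 :> F.
  by move=> c2; rewrite exprAC c2 -signr_odd n_odd.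
have p0 : p != 0.
  by apply: contraNneq P0 => ->; rewrite expr0n eqn0Ngt n_gt0 invr0 addr0.
have P2 : (p ^+ n) ^+ 2 != -1.
  by rewrite -i2 -add_inv_neq0 ?expf_neq0.
have Pc c : c ^+ 2 = -1 -> p ^+ n != c ^+ n.
  by move=> /in2 c2; apply: contraNneq P2 => ->; rewrite c2.
have z0 : z != 0.
  apply: contra_eq_neq (prim_expr_order prim_z) => ->.
  by rewrite expr0n eqn0Ngt n_gt0 eq_sym oner_eq0.
have Ni2 : (- i) ^+ 2 = -1 by rewrite sqrrN.
have tE (s : 'I_n) : (p * z ^+ s + (p * z ^+ s)^-1)^-1 =
    2%:R^-1 * ((p * z ^+ s - i)^-1 + (p * z ^+ s - - i)^-1).
  rewrite (@inv_add_inv _ i) // (@add_inv_neq0 _ i) ?mulf_neq0 ?expf_neq0 // i2.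
  (* A vanishing denominator means that [p * z ^+ s] squares to -1; its n-th power is [p ^+ n],
     which would then square to -1 too, as [n] is odd. *)
  apply: contraNneq P2 => h.
  have <- : (p * z ^+ s) ^+ n = p ^+ n.
    by rewrite exprMn exprAC (prim_expr_order prim_z) expr1n mulr1.
  by rewrite exprAC h -signr_odd n_odd.
under eq_bigr do rewrite tE.
rewrite -mulr_sumr big_split /= !(sum_inv_root_sub prim_z) ?Pc //.
have iP c : c ^+ 2 = -1 -> c ^+ n.-1 = (-1) ^+ n./2 :> F.
  move=> c2; have -> : n.-1 = (2 * n./2)%N.
    by rewrite mul2n -[in LHS](odd_double_half n) n_odd.
  by rewrite exprM c2.
(* Since [n] is odd, [i ^+ n] is again a square root of -1, so the same partial fractions expand the
   right-hand side, now at [p ^+ n]. *)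
rewrite (@inv_add_inv _ (i ^+ n)) ?in2 // !iP //.
rewrite (sqrtN1_odd_expr n_odd i2) (sqrtN1_odd_expr n_odd Ni2) mulrN.
ring.
Qed.

Lemma sum_inv_add_inv2 (F : fieldType) (n : nat) (z p q i : F) :
    odd n -> n.-primitive_root z -> 2%:R != 0 :> F -> i ^+ 2 = -1 ->
    p ^+ n + p ^- n != 0 -> q ^+ n + q ^- n != 0 ->
  \sum_(j < n) \sum_(k < n)
     (p * q * z ^+ j + (p * q * z ^+ j)^-1
        + (p / q * z ^+ k + (p / q * z ^+ k)^-1))^-1
  = n%:R ^+ 2 / ((p * q) ^+ n + (p * q) ^- n + ((p / q) ^+ n + (p / q) ^- n)).
Proof.
(* With the modulus a successor, ['I_n.+1] carries addition modulo [n.+1], which the exponents of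
   [z] respect. *)
case: n => // n n_odd prim_z two0 i2 P0 Q0.
have splitE (u v : F) : v != 0 -> u * v + (u * v)^-1 + (u / v + (u / v)^-1)
     = (u + u^-1) * (v + v^-1).
  by move=> v0; rewrite !invfM invrK; ring.
have q0 : q != 0.
  by apply: contraNneq Q0 => ->; rewrite expr0n invr0 addr0.
have z0 : z != 0.
  apply: contra_eq_neq (prim_expr_order prim_z) => ->.
  by rewrite expr0n eq_sym oner_eq0.
have zD (s t : 'I_n.+1) : z ^+ (s + t)%R = z ^+ s * z ^+ t.
  by rewrite (prim_expr_mod prim_z) exprD.
have zB (s t : 'I_n.+1) : z ^+ (s - t)%R = z ^+ s / z ^+ t.
  by apply: (mulIf (expf_neq0 t z0)); rewrite divfK ?expf_neq0 // -zD subrK.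
pose h (st : 'I_n.+1 * 'I_n.+1) := (st.1 + st.2, st.1 - st.2).
have dbl_inj : injective (fun s : 'I_n.+1 => s *+ 2).
  (* The modulus is [2h + 1] with [h = n.+1./2], so [- h] is an inverse of 2. *)
  suff K : cancel (fun s : 'I_n.+1 => s *+ 2) (fun s => - (s *+ n.+1./2)).
    exact: can_inj K.
  move=> s; apply/eqP; rewrite eq_sym -addr_eq0 -mulrnA mul2n -mulrS.
  have -> : (n.+1./2.*2).+1 = n.+1 by rewrite -[in RHS](odd_double_half n.+1) n_odd.
  by apply/eqP/val_inj; rewrite Zp_mulrn /= modnMl.
have h_inj : injective h.
  move=> [s t] [s' t'] eh.
  have e1 : s + t = s' + t' := congr1 fst eh.
  have e2 : s - t = s' - t' := congr1 snd eh.
  have dblE (a b : 'I_n.+1) : a *+ 2 = (a + b) + (a - b).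
    by rewrite mulr2n addrACA subrr addr0.
  have es : s = s' by apply: dbl_inj; rewrite /= (dblE s t) (dblE s' t') e1 e2.
  by move: e1; rewrite es => /addrI ->.
rewrite pair_big (reindex_inj h_inj) /= 2!exprMn exprVn splitE ?expf_neq0 //.
pose S u := \sum_(s < n.+1) (u * z ^+ s + (u * z ^+ s)^-1)^-1.
transitivity (S p * S q).
  (* The terms match by [splitE] with [u = p * z ^+ s] and [v = q * z ^+ t]: their product carries
     [z ^+ (s + t)], their quotient [z ^+ (s - t)]. *)
  rewrite /S mulr_suml; under [RHS]eq_bigr do rewrite mulr_sumr.
  rewrite pair_big; apply: eq_bigr => -[s t] _ /=.
  rewrite zD zB -invfM -splitE ?mulf_neq0 ?expf_neq0 //.
  congr (_ + _ + (_ + _))^-1; rewrite ?invfM; ring.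
rewrite /S !(@sum_inv_add_inv _ n.+1 z _ i) // invfM.
by rewrite mulrACA [X in X * _ = _]mulrACA -!expr2 sqrr_sign mul1r.
Qed.

(** * The Jacobi symbol at -1 *)

Lemma sqrz_eqN1_mod (p x : nat) :
  ((x%:Z) ^+ 2 == -1 %[mod p%:Z])%Z = (p %| (x ^ 2).+1)%N.
Proof.
have -> : (p %| (x ^ 2).+1)%N = (p%:Z %| ((x ^ 2).+1)%:Z)%Z by [].
by rewrite eqz_mod_dvd opprK -(addn1 (x ^ 2)) PoszD -[Posz (x ^ 2)]natz natrX natz.
Qed.

(* With p = 2m + 1, the factors m + 1, ..., 2m of (p - 1)! are -m, ..., -1
   modulo p; conclude by Wilson's theorem. *)
Lemma dvdn_sqr_fact (m : nat) : prime m.*2.+1 -> ~~ odd m ->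
  (m.*2.+1 %| (m`! ^ 2).+1)%N.
Proof.
move=> p_pr m_even; have := p_pr; rewrite Wilson ?prime_gt1 //=.
have pF := pchar_Fp p_pr.
rewrite !(dvdn_pcharf pF) -!natr1; congr (_ + 1 == 0).
have factE k : (k`!)%:R = \prod_(i < k) (i.+1)%:R :> 'F_(m.*2.+1).
  by rewrite fact_prod natr_prod big_add1 big_mkord.
rewrite natrX expr2 factE.
have -> : \prod_(i < m.*2) (i.+1)%:R = \prod_(i < m + m) (i.+1)%:R :> 'F_(m.*2.+1).
  by rewrite addnn.
rewrite big_split_ord /= -factE; congr (_ * _).
rewrite (reindex_inj rev_ord_inj) /=.
under eq_bigr => i _.
  have -> : (m + (m - i.+1)).+1%:R = -1 * (i.+1)%:R :> 'F_(m.*2.+1).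
    apply/eqP; rewrite mulN1r -addr_eq0 -natrD -(dvdn_pcharf pF) -addSn.
    by rewrite -addnA subnK // addSn addnn.
  over.
by rewrite big_split /= prodr_const card_ord -signr_odd (negbTE m_even) mul1r factE.
Qed.

(** If [x^2 = -1] modulo [p = 2m + 1] with [m] odd, Fermat's little theorem gives
    [x = x^p = (x^2)^m * x = - x]; then [p] divides 2 or [x], and neither is possible. *)
Lemma not_dvdn_sqrS (p x : nat) :
  prime p -> odd p -> odd p./2 -> ~~ (p %| (x ^ 2).+1)%N.
Proof.
move=> p_pr p_odd m_odd; have pF := pchar_Fp p_pr.
rewrite (dvdn_pcharf pF) -natr1 natrX addr_eq0; apply/eqP => x2.
have x_neq0 : x%:R != 0 :> 'F_p.
  by apply: contra_eq_neq x2 => ->; rewrite expr0n eq_sym oppr_eq0 oner_eq0.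
have xp : x%:R ^+ p = x%:R :> 'F_p.
  by rewrite -natrX -(Fp_nat_mod p_pr) fermat_little // Fp_nat_mod.
have : - x%:R = x%:R :> 'F_p.
  have pE : p = p./2.*2.+1 by rewrite -[LHS]odd_double_half p_odd.
  rewrite -[RHS]xp [X in _ ^+ X]pE exprS -mul2n exprM x2.
  by rewrite -signr_odd m_odd mulrN1.
move/eqP; rewrite eq_sym -addr_eq0 -mulr2n -[_ *+ 2]mulr_natl.
rewrite mulf_eq0 (negbTE x_neq0) orbF.
rewrite -(dvdn_pcharf pF) => /prime_nt_dvdP p2.
by rewrite p2 // gtn_eqF ?prime_gt1 in p_odd.
Qed.

(** First supplement to quadratic reciprocity. When [p./2] is even, the square root of -1 is the
    factorial of [p./2], reduced modulo [p] to lie in ['I_p]. *)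
Lemma legendreN1 (p : nat) : prime p -> odd p -> legendre (-1) p = (-1) ^+ p./2.
Proof.
move=> p_pr p_odd; rewrite /legendre.
have -> : (p%:Z %| -1)%Z = false by rewrite dvdzE /= dvdn1; case: eqP p_pr => // ->.
have pE : p = p./2.*2.+1 by rewrite -[LHS]odd_double_half p_odd.
rewrite -signr_odd; case m_odd: (odd p./2).
  case: ifP => // /existsP[x].
  by rewrite sqrz_eqN1_mod (negbTE (not_dvdn_sqrS _ p_pr p_odd m_odd)).
rewrite ifT //; apply/existsP.
have xp : (p./2`! %% p < p)%N by rewrite ltn_mod prime_gt0.
exists (Ordinal xp); rewrite sqrz_eqN1_mod /=.
rewrite /dvdn -addn1 -modnDml modnXm modnDml addn1 -/(dvdn _ _).
by rewrite [X in (X %| _)%N]pE; apply: dvdn_sqr_fact; rewrite -?pE ?m_odd.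
Qed.

(** The sign [(-1) ^+ a./2] is multiplicative in odd [a], so the values at primes extend along the
    prime decomposition of [n]. *)
Lemma jacobiN1 (n : nat) : odd n -> jacobi (-1) n = (-1) ^+ n./2.
Proof.
move=> n_odd; rewrite /jacobi.
have n_gt0 : (0 < n)%N by case: (n) n_odd.
have sgnM a b : odd a -> odd b ->
    (-1) ^+ (a * b)./2 = (-1) ^+ a./2 * (-1) ^+ b./2 :> int.
  move=> oa ob; rewrite -signr_odd -exprD -[RHS]signr_odd.
  congr (_ ^+ nat_of_bool _).
  (* For [a = 2a' + 1] and [b = 2b' + 1], the half of [a * b] is [a' + b' + 2a'b'], of the same
     parity as [a' + b']. *)
  rewrite -[in LHS](odd_double_half a) -[in LHS](odd_double_half b) oa ob.
  rewrite !add1n mulSn mulnS.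
  rewrite -doubleMl -!doubleD addSn -doubleD /= uphalf_double !oddD.
  by rewrite oddM odd_double andbF addbF addbC.
have sgnX a k : odd a -> (-1) ^+ (a ^ k)./2 = ((-1) ^+ a./2) ^+ k :> int.
  by move=> oa; elim: k => // k IH; rewrite expnS exprS sgnM ?oddX ?oa ?orbT // IH.
rewrite [in RHS](prod_prime_decomp n_gt0) prime_decompE big_map /=.
have : all odd (primes n) && all prime (primes n).
  apply/andP; split; apply/allP => p; rewrite mem_primes => /and3P[] // _ _ pn.
  exact: dvdn_odd pn n_odd.
elim: (primes n) => [|p s IHs] /=; first by rewrite !big_nil.
rewrite -andbA => /and4P[p_odd s_odd p_pr s_pr].
rewrite !big_cons sgnM ?oddX ?p_odd ?orbT //.
  by rewrite sgnX // IHs ?s_odd // legendreN1.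
(* Side condition of [sgnM]: the remaining prime powers have an odd product. *)
elim: s s_odd {IHs s_pr} => [|q s IHs] /=; first by rewrite big_nil.
by case/andP=> q_odd s_odd; rewrite big_cons oddM oddX q_odd orbT IHs.
Qed.

(** * The complex exponential, its kernel and roots of unity *)

Lemma cexpD (R : realType) (z w : R[i]) : cexp (z + w) = cexp z * cexp w.
Proof.
case: z w => [a b] [c d]; rewrite /cexp /= expRD cosD sinD.
by apply/eqP; rewrite eq_complex /=; apply/andP; split; apply/eqP; ring.
Qed.

Lemma cexp0 (R : realType) : cexp (0 : R[i]) = 1.
Proof.
rewrite /cexp /= expR0 cos0 sin0.
by apply/eqP; rewrite eq_complex /=; apply/andP; split; apply/eqP; ring.
Qed.

Lemma cexpN (R : realType) (z : R[i]) : cexp (- z) = (cexp z)^-1.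
Proof. by apply/divr1_eq; rewrite invrK -cexpD addNr cexp0. Qed.

Lemma cexp_neq0 (R : realType) (z : R[i]) : cexp z != 0.
Proof.
by apply: contra_eq_neq (cexpD z (- z)) => ->; rewrite subrr cexp0 mul0r oner_eq0.
Qed.

Lemma cexpMn (R : realType) (z : R[i]) (n : nat) : cexp (n%:R * z) = cexp z ^+ n.
Proof.
elim: n => [|n IHn]; first by rewrite mul0r cexp0.
by rewrite -natr1 mulrDl mul1r cexpD IHn exprSr.
Qed.

Lemma cexp_pihalf (R : realType) : cexp ('i%C * (pi%:C / 2%:R)) = 'i%C :> R[i].
Proof.
have -> : 'i%C * (pi%:C / 2%:R) = 0 +i* (pi / 2) :> R[i].
  apply: (@mulIf _ 2%:R); first by rewrite pnatr_eq0.
  rewrite mulrA divfK ?pnatr_eq0 //.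
  by apply/eqP; rewrite eq_complex /=; apply/andP; split; apply/eqP; field.
rewrite /cexp /= expR0 cos_pihalf sin_pihalf.
by apply/eqP; rewrite eq_complex /=; apply/andP; split; apply/eqP; ring.
Qed.

(** Reduce [x] modulo 2 pi to [r] in [0, 2 pi). Then [cos r = 1] forces [sin (r / 2) = 0], while
    sine is positive on (0, pi), so [r = 0]. *)
Lemma cos_eq1 (R : realType) (x : R) :
  cos x = 1 -> exists m : int, x = m%:~R * (pi *+ 2).
Proof.
move=> cosx.
have pi2 : 0 < pi *+ 2 :> R by rewrite mulrn_wgt0 ?pi_gt0.
pose m := Num.floor (x / (pi *+ 2)); pose r := x - m%:~R * (pi *+ 2).
have cosm (k : nat) (y : R) : cos (y + (pi *+ 2) *+ k) = cos y.
  exact: (periodicn (@cosD2pi R)).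
have cosr : cos r = 1.
  rewrite /r mulrzl; case: (m) => k.
    by rewrite -(cosm k) -pmulrn subrK.
  by rewrite NegzE mulrNz opprK -pmulrn cosm.
have r_ge0 : 0 <= r by rewrite subr_ge0 -ler_pdivlMr // ge_floor.
have r_lt : r < pi *+ 2.
  have := lt_succ_floor (x / (pi *+ 2)).
  by rewrite ltr_pdivrMr // intrD mulrDl mul1r -ltrBlDl.
exists m; apply/eqP; rewrite -subr_eq0 -/r; apply/eqP.
have : sin (r / 2) = 0.
  have : cos (r / 2 *+ 2) = 1 by rewrite -mulr_natr divfK.
  rewrite cos_mulr2n cos2sin2 => h.
  have : sin (r / 2) ^+ 2 = 0 by lra.
  by move/eqP; rewrite sqrf_eq0 => /eqP.
case: (eqVneq r 0) => // r0 sr.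
have : 0 < sin (r / 2).
  have r_gt0 : 0 < r by rewrite lt_def r0.
  by apply: sin_gt0_pi; rewrite divr_gt0 //= ltr_pdivrMr // mulr_natr.
by rewrite sr ltxx.
Qed.

Lemma cexp_eq1 (R : realType) (z : R[i]) :
  cexp z = 1 -> complex.Re z = 0 /\ cos (complex.Im z) = 1.
Proof.
case: z => a b /eqP; rewrite /cexp eq_complex /= !mul0r subr0 addr0.
move=> /andP[/eqP ec /eqP es].
have e0 := expR_gt0 a.
have s0 : sin b = 0 by move/eqP: es; rewrite mulf_eq0 gt_eqF //= => /eqP.
(* A vanishing sine leaves 1 or -1 for the cosine; [expR a * cos b = 1] with [expR a] positive
   excludes -1. *)
have c1 : cos b = 1.
  rewrite -(sin0cos1 s0) gtr0_norm //.
  by rewrite -(pmulr_rgt0 _ e0) ec ltr01.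
by split=> //; apply: expR_inj; rewrite expR0 -ec c1 mulr1.
Qed.

(** Serves both to find the exact order of [cexp] at 2 pi i / n and to turn the non-integrality
    hypotheses into nonzero denominators. *)
Lemma cexp_2pi_eq1 (R : realType) (z : R[i]) :
  cexp ('i%C * (2%:R * pi%:C * z)) = 1 -> is_integer z.
Proof.
case: z => a b /cexp_eq1[/= h /cos_eq1[m hm]].
exists m; have -> : m%:~R = (m%:~R : R)%:C by rewrite rmorph_int.
apply/eqP; rewrite eq_complex /=.
have pi0 : pi * 2 != 0 :> R by rewrite mulf_neq0 ?pnatr_eq0 // gt_eqF ?pi_gt0.
apply/andP; split; apply/eqP; apply: (mulIf pi0).
  by rewrite -[_ *+ 2]mulr_natr in hm; lra.
by lra.
Qed.

Lemma cexp_pi (R : realType) : cexp ('i%C * pi%:C) = -1 :> R[i].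
Proof.
have -> : 'i%C * pi%:C = 2%:R * ('i%C * (pi%:C / 2%:R)) :> R[i] by field.
by rewrite cexpMn cexp_pihalf sqr_i.
Qed.

(** The order [m] of this root divides [n]; conversely its [m]-th power being 1 makes [m / n] an
    integer, so [n] divides [m]. *)
Lemma prim_root_cexp (R : realType) (n : nat) : (0 < n)%N ->
  n.-primitive_root (cexp ('i%C * (2%:R * pi%:C / n%:R)) : R[i]).
Proof.
move=> n_gt0; have n0 : n%:R != 0 :> R[i] by rewrite pnatr_eq0 -lt0n.
set z := cexp _.
have [|m prim_z m_n] := @prim_order_exists _ n z n_gt0.
  rewrite /z -cexpMn.
  have -> : n%:R * ('i%C * (2%:R * pi%:C / n%:R)) = 2%:R * ('i%C * pi%:C) :> R[i].
    by field.
  by rewrite cexpMn cexp_pi sqrrN expr1n.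
suff n_m : (n %| m)%N.
  by have /eqP <- : m == n by rewrite eqn_dvd m_n n_m.
have := prim_expr_order prim_z; rewrite /z -cexpMn.
have -> : m%:R * ('i%C * (2%:R * pi%:C / n%:R)) =
    'i%C * (2%:R * pi%:C * (m%:R / n%:R)) :> R[i] by field.
move=> /cexp_2pi_eq1[k hk].
have {hk} : (m%:Z)%:~R = (k * n%:Z)%:~R :> R[i].
  by rewrite intrM -hk divfK.
move/intr_inj=> mk; have : (n%:Z %| m%:Z)%Z by rewrite mk dvdz_mull.
by rewrite dvdzE.
Qed.

(** * Complex cosines and the identity for cos + cos *)

Lemma ccosE (R : realType) (z : R[i]) :
  ccos z = (cexp ('i%C * z) + (cexp ('i%C * z))^-1) / 2%:R.
Proof. by rewrite /ccos cexpN. Qed.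

Lemma csinE (R : realType) (z : R[i]) : csin z = ccos (z - pi%:C / 2%:R).
Proof.
rewrite ccosE /csin mulrBr cexpD !cexpN cexp_pihalf.
have i0 : 'i%C != 0 :> R[i].
  apply: contra_eq_neq (sqr_i R) => ->.
  by rewrite expr0n eq_sym oppr_eq0 oner_eq0.
have iV : ('i%C)^-1 = - 'i%C :> R[i].
  by apply: (mulIf i0); rewrite mulVf // mulNr -expr2 sqr_i opprK.
rewrite !invfM invrK iV; ring.
Qed.

(** The sum vanishes only if exp(2 pi i z) = -1, that is, exp(2 pi i (z - 1/2)) = 1. *)
Lemma cexp_add_inv_neq0 (R : realType) (z : R[i]) :
  ~ is_integer (z - 1 / 2%:R) ->
  cexp ('i%C * (pi%:C * z)) + (cexp ('i%C * (pi%:C * z)))^-1 != 0.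
Proof.
move=> z_int; rewrite (@add_inv_neq0 _ 'i%C) ?cexp_neq0 ?sqr_i //.
apply/eqP => e; apply: z_int; apply: cexp_2pi_eq1.
have -> : 'i%C * (2%:R * pi%:C * (z - 1 / 2%:R)) =
  2%:R * ('i%C * (pi%:C * z)) - 'i%C * pi%:C :> R[i] by field.
by rewrite cexpD cexpMn e cexpN cexp_pi invrN1 mulrNN mulr1.
Qed.

Lemma sum_inv_ccos_add (R : realType) (n : nat) (x y : R[i]) : odd n ->
    ~ is_integer (x + y - 1 / 2%:R) -> ~ is_integer (x - y - 1 / 2%:R) ->
  \sum_(j < n) \sum_(k < n)
     1 / (ccos (2%:R * pi%:C * (x + j%:R) / n%:R)
          + ccos (2%:R * pi%:C * (y + k%:R) / n%:R))
  = n%:R ^+ 2 / (ccos (2%:R * pi%:C * x) + ccos (2%:R * pi%:C * y)).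
Proof.
move=> n_odd xDy xBy.
have n_gt0 : (0 < n)%N by case: (n) n_odd.
have n0 : n%:R != 0 :> R[i] by rewrite pnatr_eq0 -lt0n.
have two0 : 2%:R != 0 :> R[i] by rewrite pnatr_eq0.
pose z : R[i] := cexp ('i%C * (2%:R * pi%:C / n%:R)).
(* Half the frequency of the cosines: [e (x + y)] and [e (x - y)] then serve as [p] and [q], with
   product [e (x + x)] and quotient [e (y + y)]. *)
pose e w : R[i] := cexp ('i%C * (pi%:C * w / n%:R)).
have en w : e w ^+ n = cexp ('i%C * (pi%:C * w)).
  by rewrite /e -cexpMn; congr cexp; field.
have eD w w' : e (w + w') = e w * e w'.
  by rewrite /e -cexpD; congr cexp; field.
have eB w w' : e (w - w') = e w / e w'.
  by rewrite /e -cexpN -cexpD; congr cexp; field.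
have shiftE w (j : nat) :
    ccos (2%:R * pi%:C * (w + j%:R) / n%:R) =
    (e (w + w) * z ^+ j + (e (w + w) * z ^+ j)^-1) / 2%:R.
  by rewrite ccosE /e /z -cexpMn -cexpD; congr ((cexp _ + (cexp _)^-1) / _); field.
have fullE w :
    ccos (2%:R * pi%:C * w) = (e (w + w) ^+ n + e (w + w) ^- n) / 2%:R.
  by rewrite ccosE en; congr ((cexp _ + (cexp _)^-1) / _); ring.
have half c a b : c / (a / 2%:R + b / 2%:R) = 2%:R * (c / (a + b)) :> R[i].
  by rewrite -mulrDl invf_div mulrCA.
under eq_bigr => j _ do under eq_bigr => k _ do rewrite !shiftE half mul1r.
under eq_bigr do rewrite -mulr_sumr.
rewrite -mulr_sumr !fullE half; congr (_ * _).
have -> : e (x + x) = e (x + y) * e (x - y) by rewrite -eD; congr e; ring.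
have -> : e (y + y) = e (x + y) / e (x - y) by rewrite -eB; congr e; ring.
apply: (@sum_inv_add_inv2 _ n z _ _ 'i%C) => //.
- exact: prim_root_cexp.
- exact: sqr_i.
- by rewrite en cexp_add_inv_neq0.
- by rewrite en cexp_add_inv_neq0.
Qed.

(** * Quarter shifts and the identities with sines *)

Lemma ccos_sub_quarter (R : realType) (n : nat) (x : R[i]) : odd n ->
  ccos (2%:R * pi%:C * (x - n%:R / 4%:R)) =
  (-1) ^+ n./2 * csin (2%:R * pi%:C * x).
Proof.
move=> n_odd; rewrite csinE !ccosE.
(* The shift lowers the angle by [n * pi / 2], which is pi/2 plus [n./2] times pi: the first turns
   cosine into sine, the second gives the sign. *)
have -> : 'i%C * (2%:R * pi%:C * (x - n%:R / 4%:R)) =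
    'i%C * (2%:R * pi%:C * x - pi%:C / 2%:R) - n./2%:R * ('i%C * pi%:C) :> R[i].
  by rewrite -[in LHS](odd_double_half n) n_odd -muln2 natrD natrM /=; field.
rewrite cexpD cexpN cexpMn cexp_pi invr_sign invfM invr_sign; ring.
Qed.

(** As the angle is divided by [n], the phase pi/2 between sine and cosine becomes a shift of [x] by
    [n / 4], the same for every [j]. *)
Lemma csin_shift (R : realType) (n : nat) (x : R[i]) (j : nat) : (0 < n)%N ->
  csin (2%:R * pi%:C * (x + j%:R) / n%:R) =
  ccos (2%:R * pi%:C * (x - n%:R / 4%:R + j%:R) / n%:R).
Proof.
rewrite lt0n => n_gt0; have n0 : n%:R != 0 :> R[i] by rewrite pnatr_eq0.
by rewrite csinE; congr ccos; field.
Qed.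

Lemma is_integer_subn (R : realType) (z : R[i]) (k : nat) :
  is_integer (z - k%:R) -> is_integer z.
Proof.
by case=> m zm; exists (m + k%:Z); rewrite intrD -zm -pmulrn subrK.
Qed.

(** Matches the shifted cosine conditions with the quarters in the third identity: with
    [a = n./2./2], the left side is [a + 3/4] for [n = 4a + 1] and [a + 5/4] for [n = 4a + 3]. *)
Lemma odd_quarter (F : numFieldType) (n : nat) : odd n ->
  n%:R / 4%:R + 1 / 2%:R = n./2./2.+1%:R - (-1) ^+ n./2 / 4%:R :> F.
Proof.
move=> n_odd; rewrite -[in LHS](odd_double_half n) n_odd.
rewrite -[in LHS](odd_double_half n./2) -signr_odd.
by case: (odd n./2); rewrite /= -!muln2 ?(natrD, natrM) -[_.+1%:R]natr1; field.
Qed.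

Theorem theorem1p2 (R : realType) (n : nat) (n_gt0 : (0 < n)%N)
    (n_odd : odd n) :
  [/\ forall x y : R[i],
        ~ is_integer (x + y) -> ~ is_integer (x - y - 1 / 2%:R) ->
        \sum_(j < n) \sum_(k < n)
           1 / (csin (2%:R * pi%:C * (x + j%:R) / n%:R)
                + csin (2%:R * pi%:C * (y + k%:R) / n%:R))
        = (jacobi (-1) n)%:~R *
          (n%:R ^+ 2 / (csin (2%:R * pi%:C * x) + csin (2%:R * pi%:C * y))),
      forall x y : R[i],
        ~ is_integer (x + y - 1 / 2%:R) -> ~ is_integer (x - y - 1 / 2%:R) ->
        \sum_(j < n) \sum_(k < n)
           1 / (ccos (2%:R * pi%:C * (x + j%:R) / n%:R)
                + ccos (2%:R * pi%:C * (y + k%:R) / n%:R))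
        = n%:R ^+ 2 / (ccos (2%:R * pi%:C * x) + ccos (2%:R * pi%:C * y))
    & forall x y : R[i],
        ~ is_integer (x + y + (-1) ^+ ((n - 1) %/ 2) / 4%:R) ->
        ~ is_integer (x - y + (-1) ^+ ((n - 1) %/ 2) / 4%:R) ->
        \sum_(j < n) \sum_(k < n)
           1 / (csin (2%:R * pi%:C * (x + j%:R) / n%:R)
                + ccos (2%:R * pi%:C * (y + k%:R) / n%:R))
        = n%:R ^+ 2 / ((jacobi (-1) n)%:~R * csin (2%:R * pi%:C * x)
                       + ccos (2%:R * pi%:C * y))].
Proof.
have jE : (jacobi (-1) n)%:~R = (-1) ^+ n./2 :> R[i].
  by rewrite jacobiN1 // rmorphXn /= rmorphN1.
have mE : ((n - 1) %/ 2)%N = n./2.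
  by rewrite subn1 divn2 -[in LHS](odd_double_half n) n_odd add1n /= doubleK.
have quarter := odd_quarter R[i] n_odd.
have quarters (z : R[i]) :
    z - n%:R / 4%:R - 1 / 2%:R = z + (-1) ^+ n./2 / 4%:R - n./2./2.+1%:R.
  by rewrite -addrA -opprD quarter opprB addrA.
split=> x y.
- move=> xDy xBy.
  under eq_bigr => j _ do under eq_bigr => k _ do rewrite !csin_shift //.
  rewrite sum_inv_ccos_add // ?ccos_sub_quarter //.
  + by rewrite jE -mulrDr invfM invr_sign mulrCA.
  (* The two shifts add up to [n / 2], and [n / 2 + 1 / 2] is the integer [n./2.+1]; in the
     difference [x - y] they cancel. *)
  + have -> : x - n%:R / 4%:R + (y - n%:R / 4%:R) - 1 / 2%:R =
        x + y - n./2.+1%:R.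
      rewrite -[in LHS](odd_double_half n) n_odd -muln2 natrD natrM /=.
      by rewrite -[_.+1%:R in RHS]natr1; field.
    by move/is_integer_subn.
  + by rewrite opprB addrA subrK.
- exact: sum_inv_ccos_add.
- rewrite mE => xDy xBy.
  (* Only [x] is shifted here, so both conditions receive [n / 4 + 1 / 2], which [quarters] reduces
     to the signed quarter up to an integer. *)
  under eq_bigr => j _ do under eq_bigr => k _ do rewrite csin_shift //.
  rewrite sum_inv_ccos_add // ?ccos_sub_quarter // ?jE //.
  + by rewrite [x - _ + _]addrAC quarters; move/is_integer_subn.
  + by rewrite [x - _ + _]addrAC quarters; move/is_integer_subn.
Qed.
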